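(* Let $A\in\mathbb{C}^{n\times n}$, let $v\in\mathbb{C}^n$ with $\|v\|=1$, and let $\tau>0$. Let $V_k\in\mathbb{C}^{n\times k}$ (with orthonormal columns) and the $k\times k$ upper Hessenberg matrix $H_k$ be generated by $k$ iterations of the Arnoldi process for $A$ and $v$, so that $AV_k=V_kH_k+h_{k+1,k}v_{k+1}e_k^T$. Let $w_k(\tau)=V_ke^{-\tau H_k}e_1$ be the Arnoldi approximation to $w(\tau)=e^{-\tau A}v$. Then the approximation error satisfies $$\|w(\tau)-w_k(\tau)\|\le h_{k+1,k}\,e^{-\min\{\nu(A),0\}\tau}\int_0^\tau |h(t)|\,dt,$$ where $h(t):=e_k^Te^{-tH_k}e_1$ is the $(k,1)$ entry of the matrix $e^{-tH_k}$ and $\nu(A)=\lambda_{\min}\left(\frac{A+A^*}{2}\right)$.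
   Context: $\|\cdot\|$ is the Euclidean norm on vectors. $\lambda_{\min}$ denotes the smallest eigenvalue of a Hermitian matrix; equivalently $\nu(A)=\min\{\operatorname{Re}(x^*Ax): x\in\mathbb{C}^n,\ \|x\|=1\}$. Arnoldi process: starting from $v_1=v$ with $\|v\|=1$, $k$ iterations produce an orthonormal set $\{v_1,\dots,v_k,v_{k+1}\}$, a basis of the Krylov subspace $\operatorname{span}\{v,Av,\dots,A^kv\}$, via $h_{j+1,j}v_{j+1}=Av_j-\sum_{i=1}^j h_{i,j}v_i$ with $h_{j+1,j}\ge 0$ and $h_{i,j}=v_i^*Av_j$ for $i\le j$ ($1\le j\le k$). With $V_k=[v_1,\dots,v_k]$ and $H_k=[h_{ij}]_{1\le i,j\le k}$ (upper Hessenberg), one has $AV_k=V_kH_k+h_{k+1,k}v_{k+1}e_k^T$. Here $e_1,e_k$ are the first and $k$-th coordinate vectors of $\mathbb{R}^k$. *)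

(* Defs.v *)
From mathcomp Require Import all_boot all_order all_algebra.
From mathcomp Require Export complex.
From mathcomp Require Import all_classical all_reals all_analysis.
Set Implicit Arguments.
Unset Strict Implicit.
Unset Printing Implicit Defensive.
Import Order.TTheory GRing.Theory Num.Theory numFieldNormedType.Exports.
Import Normc.

Local Open Scope classical_set_scope.
Local Open Scope ring_scope.
Local Open Scope complex_scope.
Local Open Scope sesquilinear_scope.

Definition expmx (K : numFieldType) n (M : 'M[K]_n) : 'M[K]_n :=
  limn (series (fun m => m`!%:R^-1 *: M ^+ m)).

Section LinearAlgebra.
Variables (R : realType) (n : nat).
Implicit Types (x y : 'cV[R[i]]_n) (M : 'M[R[i]]_n).

Definition l2norm x : R := Num.sqrt (\sum_i normc (x i 0) ^+ 2).

Definition cdot x y : R[i] := (x ^t* *m y) 0 0.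

(* Meant for Hermitian [M], whose eigenvalues are all real. For [0 < n] the set
   below is then finite and nonempty, so that [inf] is its minimum. *)
Definition lambda_min M : R := inf [set a : R | eigenvalue M a%:C].

Definition nu M : R := lambda_min (2^-1 *: (M + M ^t*)).

End LinearAlgebra.

(* Indices are shifted by one: [arnoldi_vec A v j] is v_(j+1),
   [arnoldi_h A v i j] is h_(i+1,j+1), and [arnoldi_subdiag A v j] is
   h_(j+2,j+1). As [h_(j+1,j)] is nonnegative and
   [v_(j+1)] is a unit vector, [h_(j+1,j)] is the norm of the residual
   [A v_j - \sum_(i <= j) h_(i,j) v_i]. When the residual vanishes (breakdown),
   the next vector is set to 0. *)
Section Arnoldi.
Variables (R : realType) (n : nat) (A : 'M[R[i]]_n) (v : 'cV[R[i]]_n).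

Definition orth_residual (s : seq 'cV[R[i]]_n) : 'cV[R[i]]_n :=
  let w := A *m last 0 s in w - \sum_(u <- s) cdot u w *: u.

Fixpoint arnoldi_seq (j : nat) : seq 'cV[R[i]]_n :=
  if j is j'.+1 then
    let s := arnoldi_seq j' in
    let r := orth_residual s in rcons s ((l2norm r)^-1%:C *: r)
  else [:: v].

Definition arnoldi_vec (j : nat) : 'cV[R[i]]_n := last 0 (arnoldi_seq j).

Definition arnoldi_subdiag (j : nat) : R := l2norm (orth_residual (arnoldi_seq j)).

Definition arnoldi_h (i j : nat) : R[i] :=
  if (i <= j)%N then cdot (arnoldi_vec i) (A *m arnoldi_vec j)
  else if i == j.+1 then (arnoldi_subdiag j)%:C else 0.

Definition arnoldi_V (k : nat) : 'M[R[i]]_(n, k) :=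
  \matrix_(i < n, j < k) arnoldi_vec j i 0.

Definition arnoldi_H (k : nat) : 'M[R[i]]_k :=
  \matrix_(i < k, j < k) arnoldi_h i j.

(* The first [k] vectors are obtained without breakdown; [h_(k+1,k) = 0] is
   allowed. *)
Definition arnoldi_runs (k : nat) : Prop :=
  forall j, (j.+1 < k)%N -> arnoldi_subdiag j != 0.

Lemma arnoldi_seqE j : arnoldi_seq j = mkseq arnoldi_vec j.+1.
Proof.
elim: j => [|j IH] //.
rewrite /mkseq -[j.+2]addn1 iotaD map_cat -/(mkseq _ j.+1) -IH cats1 add0n.
by congr rcons; rewrite /arnoldi_vec /= last_rcons.
Qed.

Lemma l2norm_sq (x : 'cV[R[i]]_n) : cdot x x = (l2norm x ^+ 2)%:C.
Proof.
rewrite sqr_sqrtr ?sumr_ge0 //; last by move=> i _; rewrite sqr_ge0.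
rewrite /cdot mxE rmorph_sum; apply: eq_bigr => i _.
by rewrite !mxE mulrC -normCK rmorphXn /=; case: (x i 0).
Qed.

Lemma l2norm_eq0 (x : 'cV[R[i]]_n) : l2norm x = 0 -> x = 0.
Proof.
move=> /eqP; rewrite sqrtr_eq0 => h.
apply/matrixP => i j; rewrite ord1 mxE; apply: eq0_normc.
have : \sum_i normc (x i 0) ^+ 2 == 0.
  by rewrite eq_le h sumr_ge0 // => l _; rewrite sqr_ge0.
rewrite psumr_eq0; last by move=> l _; rewrite sqr_ge0.
by move=> /allP/(_ i (mem_index_enum _)); rewrite sqrf_eq0 => /eqP.
Qed.

Lemma cdotZr (x y : 'cV[R[i]]_n) a : cdot x (a *: y) = a * cdot x y.
Proof. by rewrite /cdot -scalemxAr mxE. Qed.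

Lemma cdotBr (x y z : 'cV[R[i]]_n) : cdot x (y - z) = cdot x y - cdot x z.
Proof. by rewrite /cdot mulmxBr !mxE. Qed.

Lemma cdot_sumr (x : 'cV[R[i]]_n) m (F : 'I_m -> 'cV[R[i]]_n) :
  cdot x (\sum_i F i) = \sum_i cdot x (F i).
Proof. by rewrite /cdot mulmx_sumr summxE. Qed.

Lemma cdotC (x y : 'cV[R[i]]_n) : cdot y x = Num.conj (cdot x y).
Proof.
rewrite /cdot !mxE rmorph_sum; apply: eq_bigr => i _.
by rewrite !mxE [RHS]rmorphM /= mulrC; congr (_ * _); exact: (esym (conjCK _)).
Qed.

Lemma arnoldi_recurrence j :
  arnoldi_h j.+1 j *: arnoldi_vec j.+1 =
  A *m arnoldi_vec j - \sum_(i < j.+1) arnoldi_h i j *: arnoldi_vec i.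
Proof.
rewrite /arnoldi_h ltnn eqxx {1}/arnoldi_vec /= last_rcons scalerA.
rewrite -/(arnoldi_subdiag j).
transitivity (orth_residual (arnoldi_seq j)).
  have [h0|hn0] := eqVneq (arnoldi_subdiag j) 0.
    by rewrite h0 mul0r scale0r (l2norm_eq0 h0).
  by rewrite -rmorphM /= divff // scale1r.
rewrite /orth_residual -/(arnoldi_vec j) arnoldi_seqE.
rewrite /mkseq big_map -[iota 0 j.+1]/(index_iota 0 j.+1) big_mkord.
by congr (_ - _); apply: eq_bigr => i _; rewrite -ltnS ltn_ord.
Qed.

Lemma arnoldi_orthonormal k : l2norm v = 1 -> arnoldi_runs k ->
  (arnoldi_V k) ^t* *m arnoldi_V k = 1%:M.
Proof.
move=> v1 runs.
suff H : forall j, (j < k)%N -> forall i l, (i <= j)%N -> (l <= j)%N ->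
    cdot (arnoldi_vec i) (arnoldi_vec l) = (i == l)%:R.
  apply/matrixP => i l; rewrite !mxE.
  have [|/ltnW] := leqP i l => h.
    rewrite -val_eqE /= -(H l (ltn_ord l) i l h (leqnn _)) /cdot mxE.
    by apply: eq_bigr => m _; rewrite !mxE.
  rewrite -val_eqE /= -(H i (ltn_ord i) i l (leqnn _) h) /cdot mxE.
  by apply: eq_bigr => m _; rewrite !mxE.
elim=> [|j IH] jk i l.
  by rewrite !leqn0 => /eqP -> /eqP ->; rewrite l2norm_sq v1 expr1n.
have {}IH := IH (ltnW jk).
have hn0 := runs _ jk.
have vE : arnoldi_vec j.+1 =
    (arnoldi_subdiag j)^-1%:C *: orth_residual (arnoldi_seq j).
  by rewrite /arnoldi_vec /= last_rcons.
have new m : (m <= j)%N -> cdot (arnoldi_vec m) (arnoldi_vec j.+1) = 0.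
  move=> mj; apply/(mulfI (x := (arnoldi_subdiag j)%:C)).
    by apply/eqP => /(congr1 (@complex.Re R)) /= /eqP; apply/negP.
  have := arnoldi_recurrence j; rewrite {1}/arnoldi_h ltnn eqxx => E.
  rewrite -cdotZr E mulr0 cdotBr cdot_sumr.
  rewrite (bigD1 (Ordinal (mj : (m < j.+1)%N))) //= big1 => [|a am].
    rewrite cdotZr IH // eqxx mulr1 addr0.
    by rewrite /arnoldi_h mj subrr.
  rewrite cdotZr IH //; last by rewrite -ltnS ltn_ord.
  by rewrite eq_sym (negbTE (_ : a != m :> nat)) ?mulr0.
rewrite [(i <= _)%N]leq_eqVlt [(l <= _)%N]leq_eqVlt !ltnS.
move=> /predU1P[->|ij] /predU1P[->|lj].
- rewrite eqxx vE cdotZr cdotC cdotZr l2norm_sq.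
  rewrite -/(arnoldi_subdiag j) -[_%:C * _%:C]rmorphM /=.
  rewrite (_ : Num.conj _ = ((arnoldi_subdiag j)^-1 * arnoldi_subdiag j ^+ 2)%:C);
    last exact: conjc_real.
  by rewrite -rmorphM /= expr2 mulKf // mulVf.
- by rewrite cdotC new // rmorph0 gtn_eqF.
- by rewrite new // ltn_eqF.
- exact: IH.
Qed.

End Arnoldi.

(* Main.v *)
Require Import Defs.
From mathcomp Require Import all_boot all_order all_algebra.
From mathcomp Require Import complex ring lra.
From mathcomp Require Import all_classical all_reals all_analysis.
Set Implicit Arguments.
Unset Strict Implicit.
Unset Printing Implicit Defensive.
Import Order.TTheory GRing.Theory Num.Theory numFieldNormedType.Exports.
Import Normc.

Local Open Scope classical_set_scope.
Local Open Scope ring_scope.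
Local Open Scope complex_scope.
Local Open Scope sesquilinear_scope.

(** The error E(t) = exp(-tA) v - V exp(-tH) e_1 starts at 0 and solves a forced
    linear equation. Indeed the Arnoldi relation A V = V H + r e_k^T, where
    r = h_(k+1,k) v_(k+1) is the last residual ([arnoldi_relation]), turns
    V H exp(-tH) e_1 into A V exp(-tH) e_1 - h(t) r, so that
      E' = - A E - h(t) r,   E(0) = 0,   |r| = h_(k+1,k).

    The bound is an energy estimate for this equation ([energy_estimate]), which
    dispenses with the variation of constants formula and with integrals of
    vector-valued functions. With mu <= nu(A), the squared norm satisfies
      (|E|^2)' = 2 Re (E^* E') <= - 2 mu |E|^2 + 2 |r| |h| |E|
    ([energy_rate]), because Re (x^* A x) >= nu(A) |x|^2 ([nu_le], a consequence
    of the spectral theorem) and by Cauchy-Schwarz. As |E| need not be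
    differentiable where E vanishes, it is replaced by
      G_eps(t) = sqrt (exp (2 mu t) |E(t)|^2 + eps^2),
    which satisfies G_eps' <= |r| |h| exp (mu t) <= |r| |h| for t >= 0 as soon
    as mu <= 0. Hence G_eps(t) - |r| int_0^t |h| is nonincreasing, and
    exp (mu tau) |E(tau)| <= G_eps(tau) <= eps + |r| int_0^tau |h| for every
    eps > 0. The theorem is the case mu = min (nu(A), 0).

    Of the matrix exponential, only exp(0) = 1 and d/dt exp(tM) = M exp(tM)
    ([mxderive_expmx]) are used. Calculus is done on real functions: the real
    and imaginary parts of the entries of exp(tM) are power series in t with
    infinite radius of convergence, which can be differentiated term by term. *)

(** * Real and imaginary parts *)

Section RealParts.
Variable R : realType.
Implicit Types (z c : R[i]) (b : bool).

(** Indexing the two parts by a boolean lets every real-variable argument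
    below be made once for both of them. *)
Definition part b z : R := if b then complex.Im z else complex.Re z.

Lemma partD b z1 z2 : part b (z1 + z2) = part b z1 + part b z2.
Proof. by case: b z1 z2 => -[? ?] [? ?]. Qed.

Lemma part0 b : part b 0 = 0.
Proof. by case: b. Qed.

Lemma part_sum b (I : Type) (s : seq I) (P : pred I) (F : I -> R[i]) :
  part b (\sum_(i <- s | P i) F i) = \sum_(i <- s | P i) part b (F i).
Proof. exact: (big_morph _ (partD b) (part0 b)). Qed.

Lemma partN b z : part b (- z) = - part b z.
Proof. by case: b z => -[]. Qed.

(** Multiplication by a constant mixes the two parts linearly over the reals;
    the sign is that of i^2 for the real part, + for the imaginary part. *)
Lemma partM b c z :
  part b (c * z) =
  part false c * part b z + (-1) ^+ (~~ b) * part true c * part (~~ b) z.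
Proof. by case: b c z => -[? ?] [? ?] /=; ring. Qed.

Lemma partZ b (x : R) z : part b (x%:C * z) = x * part b z.
Proof. by rewrite partM /= mulr0 mul0r addr0. Qed.

Lemma normc_sqr z : normc z ^+ 2 = part false z ^+ 2 + part true z ^+ 2.
Proof. by case: z => a b /=; rewrite sqr_sqrtr // addr_ge0 ?sqr_ge0. Qed.

Lemma normc_ge0 z : 0 <= normc z.
Proof. by case: z => a b /=; exact: sqrtr_ge0. Qed.

Lemma normr_normc z : `|z| = (normc z)%:C.
Proof. by case: z. Qed.

Lemma normr_part_le b z : `|part b z| <= normc z.
Proof.
rewrite -[leRHS]ger0_norm ?normc_ge0// -ler_sqr ?nnegrE//.
rewrite !real_normK ?num_real// normc_sqr.
by case: b; rewrite /= ?lerDl ?lerDr sqr_ge0.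
Qed.

Lemma normc_le_parts z : normc z <= `|part false z| + `|part true z|.
Proof.
rewrite -[leRHS]ger0_norm ?addr_ge0// -[leLHS]ger0_norm ?normc_ge0//.
rewrite -ler_sqr ?nnegrE// !real_normK ?num_real// normc_sqr sqrrD.
by rewrite !real_normK ?num_real// lerD2r lerDl mulrn_wge0// mulr_ge0.
Qed.

End RealParts.

(** * Entries of the matrix exponential *)

(** The topology on matrices is the entrywise one. Stated with a plain
    epsilon, the criterion applies to complex entries without convergence in
    the complex numbers being spelled as a filter limit. *)
Lemma mx_limnE (K : numFieldType) m n (S : nat -> 'M[K]_(m, n))
    (L : 'M[K]_(m, n)) :
    (forall i j e, 0 < e -> \forall k \near \oo, `|S k i j - L i j| < e) ->
  limn S = L.
Proof.
move=> SL; apply: cvg_lim => //; apply/cvgrPdist_lt => e e0.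
have /filter_forall : forall ij : 'I_m * 'I_n,
    \forall k \near \oo, `|S k ij.1 ij.2 - L ij.1 ij.2| < e.
  by move=> ij; exact: SL.
apply: filterS => k Sk.
have : ball L e (S k).
  split=> // i j; rewrite -ball_normE /= distrC; exact: Sk (i, j).
by rewrite mx_norm_ball.
Qed.

Section EntrySeries.
Variables (R : realType) (n : nat).
Implicit Types B M : 'M[R[i]]_n.

(** A submultiplicative norm, which makes the entries of [M ^+ m] grow at most
    geometrically. *)
Definition abs_sum M : R := \sum_i \sum_j normc (M i j).

Lemma abs_sum_ge0 M : 0 <= abs_sum M.
Proof. by do 2!apply: sumr_ge0 => ? _; exact: normc_ge0. Qed.

Lemma normc_le_abs_sum M i j : normc (M i j) <= abs_sum M.
Proof.
rewrite /abs_sum (bigD1 i)//= (bigD1 j)//= -addrA lerDl.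
rewrite addr_ge0 ?sumr_ge0// => *; rewrite ?sumr_ge0// => *;
  exact: normc_ge0.
Qed.

Lemma normc_sum (I : Type) (s : seq I) (F : I -> R[i]) :
  normc (\sum_(i <- s) F i) <= \sum_(i <- s) normc (F i).
Proof.
elim/big_ind2 : _ => [|x1 z1 x2 z2 h1 h2|//]; first by rewrite normc0.
by apply: le_trans (lerD h1 h2); exact: le_normcD.
Qed.

Lemma abs_sumM B M : abs_sum (B *m M) <= abs_sum B * abs_sum M.
Proof.
rewrite /abs_sum mulr_suml; apply: ler_sum => i _.
apply: (@le_trans _ _ (\sum_j \sum_l normc (B i l) * normc (M l j))).
  apply: ler_sum => j _; rewrite mxE; apply: le_trans (normc_sum _ _) _.
  by apply: ler_sum => l _; rewrite normcM.
rewrite exchange_big/= mulr_suml; apply: ler_sum => l _.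
rewrite -mulr_sumr ler_wpM2l ?normc_ge0//.
rewrite [leRHS](bigD1 l)//= lerDl !sumr_ge0// => *.
by rewrite sumr_ge0// => *; exact: normc_ge0.
Qed.

Lemma abs_sum_exp B M m : abs_sum (B *m M ^+ m) <= abs_sum B * abs_sum M ^+ m.
Proof.
elim: m B => [|m IH] B; first by rewrite expr0 mulmx1 expr0 mulr1.
rewrite exprS -[M * _]/(M *m _) mulmxA (le_trans (IH _))// exprS mulrA.
by rewrite ler_wpM2r ?abs_sumM// exprn_ge0// abs_sum_ge0.
Qed.

(** Taylor coefficients at 0 of one part of one entry of B exp(tM). The factor
    [B] makes the family stable under formal differentiation. *)
Definition entry_coef b B M i j (m : nat) : R :=
  part b ((B *m M ^+ m) i j) / m`!%:R.

(** Domination by the exponential series of [abs_sum M * `|x|]. *)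
Lemma cvg_entry_series b B M i j x : cvgn (pseries (entry_coef b B M i j) x).
Proof.
apply: normed_cvg.
apply: (@series_le_cvg _ _ (fun m => abs_sum B * exp_coeff (abs_sum M * `|x|) m)).
- by move=> m; exact: normr_ge0.
- move=> m; rewrite mulr_ge0 ?abs_sum_ge0// exp_coeff_ge0//.
  by rewrite mulr_ge0 ?abs_sum_ge0.
- move=> m /=; rewrite /entry_coef/= /exp_coeff/= !normrM normfV normrX.
  rewrite [`|m`!%:R|]ger0_norm// exprMn.
  rewrite [leRHS](_ : _ =
      abs_sum B * abs_sum M ^+ m / m`!%:R * `|x| ^+ m); last by ring.
  rewrite ler_wpM2r ?exprn_ge0// ler_wpM2r ?invr_ge0//.
  apply: le_trans (normr_part_le _ _) _.
  exact: le_trans (normc_le_abs_sum _ _ _) (abs_sum_exp _ _ _).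
- apply: is_cvg_seriesZ; exact: is_cvg_series_exp_coeff.
Qed.

(** Formal differentiation in t is multiplication by [M] under the sum. *)
Lemma pseries_diffs_entry b B M i j :
  pseries_diffs (entry_coef b B M i j) = entry_coef b (B *m M) M i j.
Proof.
apply/funext => m; rewrite /pseries_diffs /entry_coef exprS.
rewrite -[M * _]/(M *m _) mulmxA factS natrM.
by rewrite mulrCA invfM mulVKf ?pnatr_eq0.
Qed.

Lemma is_derive_entry_series b B M i j (x : R) :
  is_derive x 1 (fun y => limn (pseries (entry_coef b B M i j) y))
    (limn (pseries (entry_coef b (B *m M) M i j) x)).
Proof.
rewrite -pseries_diffs_entry; apply: (@pseries_snd_diffs _ _ (`|x| + 1)).
- exact: cvg_entry_series.
- by rewrite pseries_diffs_entry; exact: cvg_entry_series.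
- by rewrite !pseries_diffs_entry; exact: cvg_entry_series.
- by rewrite [ltRHS]ger0_norm// ltrDl.
Qed.

Lemma expr_scalemx M (c : R[i]) m : (c *: M) ^+ m = c ^+ m *: M ^+ m.
Proof.
elim: m => [|m IH]; first by rewrite !expr0 scale1r.
by rewrite !exprS IH -[LHS]scalemxAl -scalemxAr scalerA.
Qed.

Lemma part_expmx_series b M i j (x : R) k :
  part b (series (fun m => m`!%:R^-1 *: (x%:C *: M) ^+ m) k i j) =
  pseries (entry_coef b 1%:M M i j) x k.
Proof.
rewrite /series/= summxE part_sum; apply: eq_bigr => m _.
rewrite /= /entry_coef mul1mx expr_scalemx scalerA mxE.
rewrite (_ : m`!%:R^-1 * x%:C ^+ m = (m`!%:R^-1 * x ^+ m)%:C); last first.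
  by rewrite rmorphM rmorphXn fmorphV rmorph_nat.
by rewrite partZ; ring.
Qed.

Lemma expmxE M (x : R) :
  expmx (x%:C *: M) = \matrix_(i, j)
    (limn (pseries (entry_coef false 1%:M M i j) x) +i*
     limn (pseries (entry_coef true 1%:M M i j) x)).
Proof.
apply: mx_limnE => i j [e e'] /[!ltcE]/= /andP[/eqP -> e0].
have near_part b : \forall k \near \oo,
    `|part b (series (fun m => m`!%:R^-1 *: (x%:C *: M) ^+ m) k i j) -
      limn (pseries (entry_coef b 1%:M M i j) x)| < e / 2.
  under eq_near do rewrite part_expmx_series distrC.
  by apply: (cvgrPdist_lt _ _).1 (divr_gt0 e0 (ltr0n _ 2)); exact: cvg_entry_series.
near=> k; rewrite mxE normr_normc ltcR.
set z := _ - _; apply: le_lt_trans (normc_le_parts z) _.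
rewrite [e]splitr ltrD// /z partD partN; near: k; exact: near_part.
Unshelve. all: by end_near. Qed.

End EntrySeries.

(** * Derivatives of complex matrices along the real line *)

Section MatrixDerivative.
Variable R : realType.

Definition cderive (F : R -> R[i]) (t : R) (d : R[i]) : Prop :=
  forall b, is_derive t 1 (fun s => part b (F s)) (part b d).

Lemma cderive_lincomb m (c : 'I_m -> R[i]) (F : 'I_m -> R -> R[i]) t d :
  (forall l, cderive (F l) t (d l)) ->
  cderive (fun s => \sum_l c l * F l s) t (\sum_l c l * d l).
Proof.
move=> dF b.
pose f b' l s := part b' (F l s).
rewrite (_ : (fun s => _) = \sum_l (part false (c l) \*: f b l +
    ((-1) ^+ (~~ b) * part true (c l)) \*: f (~~ b) l)); last first.
  apply/funext => s; rewrite part_sum fct_sumE.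
  by apply: eq_bigr => l _; rewrite partM.
rewrite part_sum; apply: is_derive_sum => l; rewrite partM.
by apply: is_deriveD; apply: is_deriveZ; exact: dF.
Qed.

(** Takes the product with a constant matrix through the limit of the entry
    series. *)
Lemma cvg_part_lincomb m (c : 'I_m -> R[i]) (u : bool -> 'I_m -> R^nat)
    (z : 'I_m -> R[i]) b :
    (forall b' l, u b' l @ \oo --> part b' (z l)) ->
  (fun k => \sum_l (part false (c l) * u b l k +
    (-1) ^+ (~~ b) * part true (c l) * u (~~ b) l k)) @ \oo -->
  part b (\sum_l c l * z l).
Proof.
move=> uz; rewrite part_sum; under eq_bigr do rewrite partM.
apply: cvg_big => [|l _]; first exact: add_continuous.
by apply: cvgD; apply: cvgMr; exact: uz.
Qed.

Definition mxderive m p (F : R -> 'M[R[i]]_(m, p)) (t : R)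
    (D : 'M[R[i]]_(m, p)) : Prop :=
  forall i j, cderive (fun s => F s i j) t (D i j).

Lemma mxderive_mull m p q (B : 'M[R[i]]_(q, m)) (F : R -> 'M[R[i]]_(m, p)) t D :
  mxderive F t D -> mxderive (fun s => B *m F s) t (B *m D).
Proof.
move=> dF i j; rewrite mxE; under eq_fun do rewrite mxE.
exact: cderive_lincomb.
Qed.

Lemma mxderive_mulr m p q (B : 'M[R[i]]_(p, q)) (F : R -> 'M[R[i]]_(m, p)) t D :
  mxderive F t D -> mxderive (fun s => F s *m B) t (D *m B).
Proof.
have mulE (X : 'M[R[i]]_(m, p)) i j : (X *m B) i j = \sum_l B l j * X i l.
  by rewrite mxE; apply: eq_bigr => l _; rewrite mulrC.
move=> dF i j; rewrite mulE; under eq_fun do rewrite mulE.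
exact: cderive_lincomb.
Qed.

Lemma mxderiveB m p (F G : R -> 'M[R[i]]_(m, p)) t D1 D2 :
  mxderive F t D1 -> mxderive G t D2 ->
  mxderive (fun s => F s - G s) t (D1 - D2).
Proof.
move=> dF dG i j b; rewrite !mxE partD partN.
under eq_fun do rewrite !mxE partD partN.
by apply: is_deriveB; [exact: dF|exact: dG].
Qed.

(** Term-by-term differentiation gives the entry series of [M *m M ^+ m]; it
    remains to recognize its sum as an entry of the product of [M] by the
    exponential. *)
Lemma mxderive_expmx n (M : 'M[R[i]]_n) t :
  mxderive (fun s => expmx (s%:C *: M)) t (M *m expmx (t%:C *: M)).
Proof.
have partE b i j s : part b (expmx (s%:C *: M) i j) =
    limn (pseries (entry_coef b 1%:M M i j) s).
  by rewrite expmxE mxE; case: b.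
move=> i j b.
have -> : part b ((M *m expmx (t%:C *: M)) i j) =
    limn (pseries (entry_coef b (1%:M *m M) M i j) t).
  rewrite mul1mx mxE; apply/esym/cvg_lim => //.
  rewrite (_ : pseries _ _ = fun k => \sum_l
      (part false (M i l) * pseries (entry_coef b 1%:M M l j) t k +
       (-1) ^+ (~~ b) * part true (M i l) *
         pseries (entry_coef (~~ b) 1%:M M l j) t k)).
    pose u b' l := pseries (entry_coef b' 1%:M M l j) t.
    apply: (@cvg_part_lincomb _ _ u) => b' l; rewrite partE.
    exact: cvg_entry_series.
  apply/funext => k; rewrite /pseries /series/=.
  under [RHS]eq_bigr do rewrite !mulr_sumr -big_split/=.
  rewrite exchange_big/=; apply: eq_bigr => m _.
  rewrite /entry_coef mxE part_sum !mulr_suml; apply: eq_bigr => l _.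
  by rewrite partM !mul1mx; ring.
under eq_fun do rewrite partE.
exact: is_derive_entry_series.
Qed.

Lemma mxderive_expmxN n (M : 'M[R[i]]_n) t :
  mxderive (fun s => expmx ((- s)%:C *: M)) t (- M *m expmx ((- t)%:C *: M)).
Proof.
have scaleE s : (- s)%:C *: M = s%:C *: - M by rewrite rmorphN scaleNr scalerN.
by under eq_fun do rewrite scaleE; rewrite scaleE; exact: mxderive_expmx.
Qed.

Lemma expmx0 n : expmx (0 : 'M[R[i]]_n) = 1%:M.
Proof.
apply: mx_limnE => i j e e0; near=> k.
suff -> : series (fun m => m`!%:R^-1 *: (0 : 'M[R[i]]_n) ^+ m) k = 1%:M.
  by rewrite subrr normr0.
rewrite /series/= -[k]prednK; last by near: k; exists 1%N.
rewrite big_nat_recl//= fact0 invr1 scale1r big1_seq ?addr0// => m _.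
by rewrite exprS mul0r scaler0.
Unshelve. all: by end_near. Qed.

End MatrixDerivative.

(** * Euclidean norm and numerical range *)

Lemma adjointK (R : realType) m n (A : 'M[R[i]]_(m, n)) : A ^t* ^t* = A.
Proof. exact: trmxCK. Qed.

Section EuclideanNorm.
Variables (R : realType) (n : nat).
Implicit Types (x y : 'cV[R[i]]_n) (A M : 'M[R[i]]_n).

Lemma l2norm_ge0 x : 0 <= l2norm x.
Proof. exact: sqrtr_ge0. Qed.

Lemma l2norm_sqE x : l2norm x ^+ 2 = \sum_i normc (x i 0) ^+ 2.
Proof. by rewrite sqr_sqrtr// sumr_ge0// => i _; exact: sqr_ge0. Qed.

Lemma cdot_mulmxr x A y : cdot x (A *m y) = cdot (A ^t* *m x) y.
Proof. by rewrite /cdot trmx_mul map_mxM/= adjointK mulmxA. Qed.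

Lemma part_cdot x y :
  part false (cdot x y) = \sum_i (part false (x i 0) * part false (y i 0) +
                                  part true (x i 0) * part true (y i 0)).
Proof.
rewrite /cdot mxE part_sum; apply: eq_bigr => i _; rewrite !mxE.
by case: (x i 0) (y i 0) => [a b] [c d] /=; rewrite mulNr opprK.
Qed.

Lemma normc_cdot_le x y : normc (cdot x y) <= l2norm x * l2norm y.
Proof.
rewrite -ler_sqr ?nnegrE ?normc_ge0 ?mulr_ge0 ?l2norm_ge0// exprMn -lecR.
have dotE (u w : 'cV[R[i]]_n) : cdot u w = dotmx (u ^t*) (w ^t*).
  by rewrite dotmxE adjointK.
rewrite rmorphXn rmorphM/= -normr_normc -!l2norm_sq !dotE.
exact: (CauchySchwarz (@dotmx R[i] n) (x ^t*) (y ^t*)).1.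
Qed.

(** The skew-Hermitian part of [A] contributes nothing to Re (x^* A x). *)
Lemma part_adjoint x A :
  part false (cdot x (A ^t* *m x)) = part false (cdot x (A *m x)).
Proof. by rewrite [in RHS]cdot_mulmxr [in RHS]cdotC; case: (cdot x _). Qed.

Lemma hermsymmx_half_sum A : 2^-1 *: (A + A ^t*) \is hermsymmx.
Proof.
apply/is_hermitianmxP; rewrite expr0 scale1r; apply/matrixP => i j.
by rewrite !mxE/= rmorphM rmorphD/= conjCK fmorphV/= rmorph_nat addrC.
Qed.

(** In an eigenbasis, an eigenvector for [a] has a nonzero coordinate, and
    there the diagonal entry has to be [a]; conversely the basis consists of
    eigenvectors. *)
Lemma eigenvalue_spectral_diag M : M \is hermsymmx ->
  forall a, eigenvalue M a = [exists i, spectral_diag M 0 i == a].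
Proof.
move=> Mh a; have /orthomx_spectralP := hermitian_normalmx Mh.
set P := spectralmx M; set d := spectral_diag M => ME.
have Pu : P \in unitmx by exact: spectral_unit.
have PM : P *m M = diag_mx d *m P by rewrite {1}ME !mulmxA mulmxV// mul1mx.
apply/eigenvalueP/existsP => [[w wM w0]|[i /eqP <-]].
  have [i zi0] : exists i, (w *m invmx P) 0 i != 0.
    apply/existsP; rewrite -negb_forall; apply: contra w0 => /forallP z0.
    rewrite -(mulmxKV Pu w); apply/eqP/matrixP => k j.
    rewrite ord1 (_ : w *m invmx P = 0) ?mul0mx//.
    by apply/matrixP => l i; rewrite ord1 [RHS]mxE; apply/eqP; exact: z0.
  exists i; apply/eqP/(mulfI zi0).
  have : w *m invmx P *m diag_mx d = a *: (w *m invmx P).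
    by rewrite scalemxAl -wM {1}ME !mulmxA mulmxK.
  by move=> /matrixP/(_ 0 i); rewrite mul_mx_diag !mxE [RHS]mulrC.
exists (row i P).
  by rewrite -row_mul PM mul_diag_mx; apply/matrixP => k j; rewrite !mxE.
apply/eqP => /(congr1 (mulmx^~ (invmx P))); rewrite -row_mul mulmxV// mul0mx.
by move/matrixP/(_ 0 i); rewrite !mxE eqxx => /eqP; rewrite oner_eq0.
Qed.

(** In orthonormal eigencoordinates y of x, the form is the sum of the d_i
    |y_i|^2. The infimum that defines [lambda_min] is a lower bound of the d_i
    because the spectrum, being finite, is bounded below. *)
Lemma lambda_min_le M x : M \is hermsymmx ->
  lambda_min M * l2norm x ^+ 2 <= part false (cdot x (M *m x)).
Proof.
move=> Mh; have /orthomx_spectralP := hermitian_normalmx Mh.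
have eigE := eigenvalue_spectral_diag Mh.
have dreal := hermitian_spectral_diag_real Mh.
have Pu := spectral_unitarymx M.
set P := spectralmx M in Pu *; set d := spectral_diag M in eigE dreal * => ME.
have dE i : d 0 i = (complex.Re (d 0 i))%:C.
  by rewrite RRe_real//; exact: (mxOverP dreal).
have le_d i : lambda_min M <= complex.Re (d 0 i).
  apply: ge_inf; last by rewrite /= -dE eigE; apply/existsP; exists i.
  exists (- \sum_i `|complex.Re (d 0 i)|) => a /=.
  rewrite eigE => /existsP[j /eqP dj].
  rewrite lerNl (bigD1 j)//= dj/= ler_wpDr ?sumr_ge0//.
  by rewrite -normrN ler_norm.
have quad (D : 'M[R[i]]_n) :
    cdot x (invmx P *m D *m P *m x) = cdot (P *m x) (D *m (P *m x)).
  by rewrite invmx_unitary// -!mulmxA [LHS]cdot_mulmxr adjointK.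
have normP : l2norm (P *m x) ^+ 2 = l2norm x ^+ 2.
  have := quad 1%:M; rewrite mulmx1 mulVmx ?unitarymx_unit// !mul1mx.
  by rewrite !l2norm_sq => /(congr1 (part false)).
rewrite -normP {2}ME quad l2norm_sqE part_cdot mulr_sumr; apply: ler_sum => i _.
rewrite mul_diag_mx [(\matrix_(_, _) _) i 0]mxE dE !partZ normc_sqr.
rewrite [leRHS](_ : _ = complex.Re (d 0 i) *
  (part false ((P *m x) i 0) ^+ 2 + part true ((P *m x) i 0) ^+ 2)).
  by rewrite ler_wpM2r// addr_ge0 ?sqr_ge0.
by ring.
Qed.

Lemma nu_le A x : nu A * l2norm x ^+ 2 <= part false (cdot x (A *m x)).
Proof.
apply: le_trans (lambda_min_le x (hermsymmx_half_sum A)) _.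
rewrite -scalemxAl cdotZr mulmxDl {1}/cdot mulmxDr mxE -!/(cdot _ _).
rewrite (_ : 2^-1 = (2^-1)%:C); last by rewrite fmorphV rmorph_nat.
by rewrite partZ partD part_adjoint; lra.
Qed.

End EuclideanNorm.

(** * The energy estimate *)

Section EnergyEstimate.
Variables (R : realType) (n : nat).

Lemma is_derive_l2norm_sq (E : R -> 'cV[R[i]]_n) t D : mxderive E t D ->
  is_derive t 1 (fun s => l2norm (E s) ^+ 2) (2 * part false (cdot (E t) D)).
Proof.
move=> dE; pose e b i s := part b (E s i 0).
under eq_fun do rewrite l2norm_sqE.
rewrite (_ : (fun s => _) = \sum_i (e false i ^+ 2 + e true i ^+ 2)); last first.
  apply/funext => s; rewrite fct_sumE; apply: eq_bigr => i _.
  by rewrite normc_sqr.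
rewrite part_cdot mulr_sumr; apply: is_derive_sum => i.
have de b : is_derive t 1 (e b i) (part b (D i 0)) by exact: dE.
apply: is_derive_eq; rewrite /GRing.scale/= /e; ring.
Qed.

(** The left-hand side is exp(-2 mu t) times the derivative of exp(2 mu t)
    |E|^2 when E = x and E' = - A x - c r. *)
Lemma energy_rate A (r x : 'cV[R[i]]_n) c (mu : R) : mu <= nu A ->
  2 * mu * l2norm x ^+ 2 + 2 * part false (cdot x (- (A *m x) - c *: r)) <=
  2 * (l2norm r * normc c * l2norm x).
Proof.
move=> muA.
have lin : part false (cdot x (- (A *m x) - c *: r)) =
    - part false (cdot x (A *m x)) - part false (c * cdot x r).
  by rewrite cdotBr cdotZr -scaleN1r cdotZr mulN1r partD !partN.
have force : - part false (c * cdot x r) <= l2norm r * normc c * l2norm x.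
  rewrite -partN (le_trans (ler_norm _))// (le_trans (normr_part_le _ _))//.
  rewrite normcN normcM [leRHS](_ : _ = normc c * (l2norm x * l2norm r)).
    by rewrite ler_wpM2l ?normc_ge0 ?normc_cdot_le.
  by ring.
have : mu * l2norm x ^+ 2 <= part false (cdot x (A *m x)).
  by apply: le_trans (nu_le A x); rewrite ler_wpM2r ?sqr_ge0.
rewrite lin; lra.
Qed.

(** Plays the part of Duhamel's formula. The forcing at time s enters with the
    weight exp (mu s), at most 1 as mu <= 0, hence the plain integral of |h|. *)
Lemma energy_estimate A (r : 'cV[R[i]]_n) (h : R -> R[i])
    (E : R -> 'cV[R[i]]_n) (tau mu : R) :
    0 < tau -> mu <= 0 -> mu <= nu A ->
    continuous (fun t => normc (h t)) ->
    E 0 = 0 -> (forall t, mxderive E t (- (A *m E t) - h t *: r)) ->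
  l2norm (E tau) <= l2norm r * expR (- (mu * tau)) *
    \int[lebesgue_measure]_(t in `[0, tau]) normc (h t).
Proof.
move=> tau0 mu0 muA hc E0 dE.
pose N s := l2norm (E s) ^+ 2.
pose I x := (\int[lebesgue_measure]_(t in `[0%R, x]) normc (h t))%R.
rewrite -/(I tau) mulrAC.
have inth b : lebesgue_measure.-integrable `[0%R, b]
    (EFin \o (fun t => normc (h t))).
  apply: continuous_compact_integrable; first exact: segment_compact.
  exact: continuous_subspaceT.
rewrite expRN -ler_pdivrMr ?invr_gt0 ?expR_gt0// invrK.
apply/ler_addgt0Pr => eps eps0.
(* The shift by eps^2 keeps the square root differentiable at the zeros of E. *)
pose g s := expR (2 * mu * s) * N s + eps ^+ 2.
have g0 s : 0 < g s by rewrite ltr_wpDl ?exprn_gt0// mulr_ge0 ?expR_ge0 ?sqr_ge0.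
have scaleE s : l2norm (E s) * expR (mu * s) <= Num.sqrt (g s).
  rewrite -[leLHS]ger0_norm ?mulr_ge0 ?expR_ge0 ?l2norm_ge0// -sqrtr_sqr.
  rewrite ler_wsqrtr// exprMn /g mulrC -expRM_natl.
  by rewrite -mulrA lerDl sqr_ge0.
pose D s := (2 * Num.sqrt (g s))^-1 * (expR (2 * mu * s) *
  (2 * mu * N s + 2 * part false (cdot (E s) (- (A *m E s) - h s *: r)))).
have dg (s : R) : is_derive s 1 g (expR (2 * mu * s) *
    (2 * mu * N s + 2 * part false (cdot (E s) (- (A *m E s) - h s *: r)))).
  pose k : R -> R := (2 * mu) \*: id.
  have dexp : is_derive s 1 (expR \o k) (expR (k s) * (2 * mu * 1)).
    exact: is_derive1_comp.
  have dN := is_derive_l2norm_sq (dE s).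
  rewrite (_ : g = (expR \o k) * N + cst (eps ^+ 2))//.
  by apply: is_derive_eq; rewrite /GRing.scale/= /N; ring.
have dG (s : R) : is_derive s 1 (Num.sqrt \o g) (D s).
  by apply: is_derive1_comp; exact: is_derive1_sqrt.
have D_le s : D s <= l2norm r * normc (h s) * expR (mu * s).
  rewrite /D mulrC ler_pdivrMr ?mulr_gt0 ?sqrtr_gt0//.
  apply: le_trans (ler_wpM2l (expR_ge0 _) (energy_rate r (E s) (h s) muA)) _.
  rewrite [leLHS](_ : _ = l2norm r * normc (h s) * expR (mu * s) * 2 *
      (l2norm (E s) * expR (mu * s))); last first.
    by rewrite -mulrA expRM_natl; ring.
  rewrite [leRHS]mulrA ler_wpM2l//.
  by rewrite !mulr_ge0 ?l2norm_ge0 ?normc_ge0 ?expR_ge0.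
pose Phi s := Num.sqrt (g s) - l2norm r * I s.
suff : Phi tau <= Phi 0.
  have -> : Phi 0 = eps.
    rewrite /Phi /I set_itv1 Rintegral_set1 mulr0 subr0 /g /N E0.
    rewrite (_ : l2norm 0 = 0) ?expr0n/= ?mulr0 ?add0r ?sqrtr_sqr ?gtr0_norm//.
    by rewrite /l2norm big1 ?sqrtr0// => i _; rewrite mxE normc0 expr0n.
  rewrite /Phi lerBlDr addrC; exact: le_trans (scaleE tau).
have dI (s : R) : s \in `]0, tau[ -> derivable I s 1 /\ derive1 I s = normc (h s).
  rewrite in_itv/= => /andP[s0 stau].
  apply: (continuous_FTC1_closed stau) => //; exact: hc.
have dPhi (s : R) : s \in `]0, tau[ ->
    is_derive s 1 Phi (D s - l2norm r * normc (h s)).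
  move=> /dI[dIs I's]; apply: is_deriveB.
  apply: is_deriveZ; rewrite -I's derive1E; exact: derivableP.
apply: (@ler0_derive1_le_cc _ _ 0 tau).
- by move=> s /dPhi[].
- move=> s sin; rewrite derive1E; have [_ ->] := dPhi _ sin.
  rewrite subr_le0 (le_trans (D_le s))// ler_piMr ?mulr_ge0 ?l2norm_ge0 ?normc_ge0//.
  move: sin; rewrite in_itv/= => /andP[s0 _].
  by rewrite -expR0 ler_expR mulr_le0_ge0// ltW.
- have cG : {within `[0, tau], continuous (Num.sqrt \o g)}.
    apply: continuous_subspaceT => s; apply/differentiable_continuous/derivable1_diffP.
    by have [] := dG s.
  have cI := parameterized_integral_continuous (ltW tau0) (inth tau).
  move=> s; apply: cvgB; first exact: cG.
  by apply: cvgM; [exact: cvg_cst|exact: cI].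
- by rewrite in_itv/= lexx ltW.
- by rewrite in_itv/= lexx ltW.
- exact: ltW.
Qed.

End EnergyEstimate.

(** * The Arnoldi relation and the theorem *)

Lemma continuous_normc (R : realType) (h d : R -> R[i]) :
  (forall t, cderive h t (d t)) -> continuous (fun t => normc (h t)).
Proof.
move=> dh; have cpart b : continuous (fun t => part b (h t)).
  by move=> t; apply/differentiable_continuous/derivable1_diffP; have [] := dh t b.
rewrite (_ : (fun t => normc _) = Num.sqrt \o
    (fun t => part false (h t) ^+ 2 + part true (h t) ^+ 2)); last first.
  by apply/funext => t /=; case: (h t).
move=> t; apply: continuous_comp; last exact: sqrt_continuous.
by apply: cvgD; rewrite expr2; under eq_cvg do rewrite expr2; apply: cvgM;
  exact: cpart.
Qed.

Section KrylovRelation.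
Variables (R : realType) (n : nat) (A : 'M[R[i]]_n) (v : 'cV[R[i]]_n).

Lemma orth_residualE j : orth_residual A (arnoldi_seq A v j) =
  A *m arnoldi_vec A v j -
    \sum_(i < j.+1) arnoldi_h A v i j *: arnoldi_vec A v i.
Proof.
rewrite /orth_residual -/(arnoldi_vec A v j) arnoldi_seqE.
rewrite /mkseq big_map -[iota 0 j.+1]/(index_iota 0 j.+1) big_mkord.
congr (_ - _); apply: eq_bigr => i _.
by rewrite /arnoldi_h -ltnS ltn_ord.
Qed.

(** Before the last column, the coefficients on [v_(i+1)] vanish for [i > j +
    1], and the one for [i = j + 1] carries the residual; in the last column
    that term lies outside the sum and is left over. *)
Lemma arnoldi_column j k : (j <= k)%N ->
  A *m arnoldi_vec A v j =
  \sum_(i < k.+1) arnoldi_h A v i j *: arnoldi_vec A v i +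
    (j == k)%:R *: orth_residual A (arnoldi_seq A v k).
Proof.
rewrite leq_eqVlt => /predU1P[->|jk].
  by rewrite eqxx scale1r orth_residualE addrC subrK.
rewrite (ltn_eqF jk) scale0r addr0.
rewrite -(big_mkord xpredT (fun i => arnoldi_h A v i j *: arnoldi_vec A v i)).
rewrite (@big_cat_nat _ _ _ j.+1)//=; last by rewrite ltnS ltnW.
rewrite big_mkord big_ltn// [X in _ + (_ + X)]big_nat_cond.
rewrite [X in _ + (_ + X)]big1 ?addr0.
  by rewrite arnoldi_recurrence [RHS]addrC subrK.
move=> i; rewrite andbT => /andP[ji _].
by rewrite /arnoldi_h leqNgt (ltnW ji)/= gtn_eqF// scale0r.
Qed.

(** The last term is written with the residual rather than
    with [h_(k+1,k) *: v_(k+1)], so that its norm is [arnoldi_subdiag] by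
    definition. *)
Lemma arnoldi_relation k :
  A *m arnoldi_V A v k.+1 = arnoldi_V A v k.+1 *m arnoldi_H A v k.+1 +
    orth_residual A (arnoldi_seq A v k) *m (delta_mx ord_max ord0)^T.
Proof.
apply/matrixP => i j.
move: (orth_residual _ _) (arnoldi_column (ltn_ord j : (j <= k)%N)) => r.
move=> /matrixP/(_ i 0); rewrite !mxE summxE big_ord1 !mxE => col.
rewrite (_ : \sum_l _ = \sum_l A i l * arnoldi_vec A v j l 0); last first.
  by apply: eq_bigr => l _; rewrite !mxE.
rewrite col; congr (_ + _).
  by apply: eq_bigr => l _; rewrite !mxE mulrC.
by rewrite andbT mulrC.
Qed.

Lemma arnoldi_V_e1 k : arnoldi_V A v k.+1 *m delta_mx ord0 ord0 = v.
Proof.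
by rewrite -colE; apply/matrixP => i j; rewrite ord1 !mxE.
Qed.

End KrylovRelation.

(* [k.+1] iterations are made, so that there is at least one. *)
Theorem theorem3p1 (R : realType) (n k : nat) (A : 'M[R[i]]_n)
    (v : 'cV[R[i]]_n) (tau : R)
    (v_unit : l2norm v = 1)
    (tau_gt0 : 0 < tau)
    (runs : arnoldi_runs A v k.+1) :
  let V : 'M[R[i]]_(n, k.+1) := arnoldi_V A v k.+1 in
  let H : 'M[R[i]]_k.+1 := arnoldi_H A v k.+1 in
  let e_1 : 'cV[R[i]]_k.+1 := delta_mx ord0 ord0 in
  let e_k : 'cV[R[i]]_k.+1 := delta_mx ord_max ord0 in
  let w : 'cV[R[i]]_n := expmx ((- tau)%:C *: A) *m v in
  let w_k : 'cV[R[i]]_n := V *m expmx ((- tau)%:C *: H) *m e_1 in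
  let h (t : R) : R[i] :=
    (e_k^T *m expmx ((- t)%:C *: H) *m e_1) ord0 ord0 in
  l2norm (w - w_k) <=
    arnoldi_subdiag A v k * expR (- (Num.min (nu A) 0 * tau)) *
    \int[lebesgue_measure]_(t in `[0, tau]) Normc.normc (h t).
Proof.
lazy zeta; set V := arnoldi_V A v k.+1; set H := arnoldi_H A v k.+1.
set e_1 := delta_mx ord0 ord0; set e_k := delta_mx ord_max ord0.
pose r := orth_residual A (arnoldi_seq A v k).
pose u (t : R) := expmx ((- t)%:C *: H) *m e_1.
pose h (t : R) := (e_k^T *m expmx ((- t)%:C *: H) *m e_1) ord0 ord0.
pose E (t : R) := expmx ((- t)%:C *: A) *m v - V *m u t.
have du t : mxderive u t (- H *m u t).
  by rewrite /u mulmxA; exact/mxderive_mulr/mxderive_expmxN.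
have hE t : h t *: r = r *m (e_k^T *m u t).
  by rewrite [e_k^T *m u t]mx11_scalar mul_mx_scalar mulmxA.
rewrite -[V *m _ *m e_1]mulmxA -/(u tau) -/(E tau).
apply: (@energy_estimate _ _ A r h E).
- exact: tau_gt0.
- by rewrite ge_min lexx orbT.
- by rewrite ge_min lexx.
- apply: (@continuous_normc _ _ (fun t => (e_k^T *m (- H *m u t)) ord0 ord0)) => t.
  have := mxderive_mull e_k^T (du t) ord0 ord0.
  by rewrite /u; under eq_fun do rewrite mulmxA.
- by rewrite /E /u oppr0 !scale0r !expmx0 !mul1mx arnoldi_V_e1 subrr.
move=> t; rewrite hE.
rewrite (_ : - _ - _ = - A *m expmx ((- t)%:C *: A) *m v - V *m (- H *m u t)).
  apply: mxderiveB; last exact: mxderive_mull.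
  exact/mxderive_mulr/mxderive_expmxN.
(* The Arnoldi relation makes the evolution generated by H follow that of - A, up
   to the residual. *)
have VH (x : 'cV_k.+1) :
    V *m (- H *m x) = r *m (e_k^T *m x) - A *m (V *m x).
  rewrite mulNmx mulmxN !mulmxA arnoldi_relation mulmxDl opprD addrCA.
  by rewrite subrr addr0.
rewrite VH /E mulmxBr !mulNmx -(mulmxA A); move: (r *m _) => z.
by rewrite !opprB addrAC [LHS]addrC.
Qed.
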